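(* Two orthogonal partial flags $\{V_j\}_{j=1}^r$ and $\{W_i\}_{i=1}^s$ in $\mathbb{R}^N$ are equivalent (with respect to $O(N)$, respectively $SO(N)$) if and only if $r=s$ and the corresponding partitions of $N$, $(N_1,\dots,N_r)$ and $(M_1,\dots,M_s)$, with $N_j=\dim V_j$ and $M_i=\dim W_i$, are equivalent.
   Context: An orthogonal partial flag of length $r$ in $\mathbb{R}^N$ is an orthogonal decomposition $\mathbb{R}^N=\bigoplus_{j=1}^r V_j$ into nonzero pairwise orthogonal subspaces (the successive orthogonal complements of a partial flag $\{0\}=V^0\subsetneq V^1\subsetneq\dots\subsetneq V^r=\mathbb{R}^N$). The group $O(N)$ (respectively $SO(N)$) acts by $g\{V_j\}_{j=1}^r=\{gV_j\}_{j=1}^r$. Two orthogonal partial flags are equivalent if there exists $g\in O(N)$, respectively $g\in SO(N)$, with $g\{V_j\}_{j=1}^r=\{W_i\}_{i=1}^s$ (equality of families, irrespective of the ordering of the indices). A partition of $N$ of length $r$ is a sequence of positive integers $N_1,\dots,N_r$ with sum $N$. Partitions $(N_1,\dots,N_r)$ and $(M_1,\dots,M_s)$ are equivalent if $r=s$ and there is a permutation $\sigma$ of $\{1,\dots,r\}$ with $N_j=M_{\sigma(j)}$ for all $j$. *)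

(* Defs.v *)
From HB Require Import structures.
From mathcomp Require Import all_boot all_order all_algebra all_fingroup reals.

Set Implicit Arguments.
Unset Strict Implicit.
Unset Printing Implicit Defensive.

Import GRing.Theory.
Local Open Scope ring_scope.

Definition orthogonal_subspaces (R : realType) (N : nat)
    (U V : {vspace 'cV[R]_N}) : Prop :=
  forall u v, u \in U -> v \in V -> u^T *m v = 0.

Record orthoflag (R : realType) (N : nat) := OrthoFlag {
  flag_length : nat;
  flag_space : 'I_flag_length -> {vspace 'cV[R]_N};
  flag_neq0 : forall j, flag_space j != 0%VS;
  flag_orthogonal : forall i j, i != j ->
    orthogonal_subspaces (flag_space i) (flag_space j);
  flag_direct : directv (\sum_j flag_space j)%VS;
  flag_full : (\sum_j flag_space j)%VS = fullv
}.

Definition orthogonal_group (R : realType) (N : nat) : {pred 'M[R]_N} :=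
  [pred g : 'M[R]_N | g^T *m g == 1%:M].
Arguments orthogonal_group : clear implicits.

Definition special_orthogonal_group (R : realType) (N : nat) :
    {pred 'M[R]_N} :=
  [pred g : 'M[R]_N | (g \in orthogonal_group R N) && (\det g == 1)].
Arguments special_orthogonal_group : clear implicits.

Definition act_space (R : realType) (N : nat) (g : 'M[R]_N)
    (U : {vspace 'cV[R]_N}) : {vspace 'cV[R]_N} :=
  (linfun (mulmx g) @: U)%VS.

(* The bijection [s] expresses equality of the families [g V_j] and [W_i] up
   to the ordering of their indices; the lengths are not assumed equal. *)
Definition orthoflag_equiv (R : realType) (N : nat) (G : {pred 'M[R]_N})
    (V W : orthoflag R N) : Prop :=
  exists2 g : 'M[R]_N, g \in G &
    exists2 s : 'I_(flag_length V) -> 'I_(flag_length W), bijective s &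
      forall j, act_space g (flag_space j) = flag_space (s j).

(* Parts are not required to be sorted. *)
Record npartition (N : nat) := NPartition {
  part_length : nat;
  part : 'I_part_length -> nat;
  part_gt0 : forall j, (0 < part j)%N;
  part_sum : (\sum_j part j)%N = N
}.

Definition npartition_equiv (N : nat) (P Q : npartition N) : Prop :=
  exists (e : part_length P = part_length Q) (s : 'S_(part_length P)),
    forall j, part j = part (cast_ord e (s j)).

Lemma flag_dim_gt0 (R : realType) (N : nat) (V : orthoflag R N)
    (j : 'I_(flag_length V)) : (0 < \dim (flag_space j))%N.
Proof. by rewrite lt0n dimv_eq0 flag_neq0. Qed.

Lemma flag_dim_sum (R : realType) (N : nat) (V : orthoflag R N) :
  (\sum_(j < flag_length V) \dim (flag_space j))%N = N.
Proof.
by have /directvP/= <- := flag_direct V; rewrite flag_full dimvf /dim /= muln1.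
Qed.

Definition flag_partition (R : realType) (N : nat) (V : orthoflag R N) :
    npartition N :=
  NPartition (@flag_dim_gt0 R N V) (flag_dim_sum V).

(* Main.v *)
(* An orthogonal flag amounts to a choice of orthonormal frames A_j of its
   blocks, with A_i^T A_j = 0 for i <> j and \sum_j A_j A_j^T = 1.  If the blocks
   V_j and W_(s j) have equal dimensions and frames A_j and B_j, then
   g = \sum_j B_j A_j^T is orthogonal and sends V_j onto W_(s j).  When
   \det g = -1, precompose g with the reflection along a unit vector of some V_j:
   it stabilizes every block of the flag and has determinant -1. *)
Require Import Defs.
From HB Require Import structures.
From mathcomp Require Import all_boot all_order all_algebra all_fingroup reals.

Set Implicit Arguments.
Unset Strict Implicit.
Unset Printing Implicit Defensive.

Import Order.TTheory GRing.Theory Num.Theory.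

Local Open Scope ring_scope.

(** Sylvester's determinant identity: both sides of the block equation factor the matrix with rows
    [(1, A)] and [(-B, 1)] into block-triangular matrices. It reduces the determinant of a
    reflection to a 1 by 1 determinant. *)
Lemma det_add1_mul (R : comNzRingType) (m n : nat)
    (A : 'M[R]_(m, n)) (B : 'M[R]_(n, m)) :
  \det (1%:M + A *m B) = \det (1%:M + B *m A).
Proof.
have /(congr1 determinant) :
    block_mx (1%:M + A *m B) A 0 1%:M *m block_mx 1%:M 0 (- B) 1%:M
    = block_mx 1%:M 0 (- B) 1%:M *m block_mx 1%:M A 0 (1%:M + B *m A)
    :> 'M_(m + n).
  rewrite !mulmx_block !(mul1mx, mulmx1, mul0mx, mulmx0, addr0, add0r).
  by rewrite mulmxN mulNmx addrK addrCA addNr addr0.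
by rewrite !det_mulmx !det_ublock !det_lblock !det1 !(mulr1, mul1r).
Qed.

Lemma tr_mulmx_eq0 (R : realDomainType) (n : nat) (u : 'cV[R]_n) :
  (u^T *m u == 0) = (u == 0).
Proof.
apply/eqP/eqP => [/matrixP/(_ 0 0)|->]; last by rewrite mulmx0.
rewrite !mxE => /eqP; rewrite psumr_eq0 => [/allP u0|i _]; last first.
  by rewrite mxE -expr2 sqr_ge0.
apply/colP => i; have := u0 i (mem_index_enum i).
by rewrite !mxE /= mulf_eq0 orbb => /eqP.
Qed.

Lemma exists_unit_vector (R : rcfType) (n : nat) (U : {vspace 'cV[R]_n}) :
  U != 0%VS -> exists2 e, e \in U & e^T *m e = 1%:M.
Proof.
move=> U0; pose u := vpick U; pose c := (u^T *m u) 0 0.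
have uu : u^T *m u = c%:M by rewrite [LHS]mx11_scalar.
have c_gt0 : 0 < c.
  rewrite lt_neqAle eq_sym; apply/andP; split.
    apply: contra_neq U0 => c0; apply/eqP; rewrite -vpick0 -tr_mulmx_eq0.
    by rewrite -/u uu c0 raddf0.
  by rewrite /c mxE sumr_ge0// => i _; rewrite mxE -expr2 sqr_ge0.
exists ((Num.sqrt c)^-1 *: u); first by rewrite memvZ ?memv_pick.
rewrite -scalemxAr [(_ *: u)^T]linearZ/= -scalemxAl uu scalerA -invfM -expr2.
by rewrite sqr_sqrtr ?ltW// scale_scalar_mx mulVf ?gt_eqF.
Qed.

(** Gram-Schmidt by induction on the dimension: split off a unit vector [e] of [U] and recurse on
    the part of [U] orthogonal to [e]. The last clause makes [A *m A^T] act as the orthogonal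
    projector onto [U]. *)
Lemma exists_orthonormal_frame (R : rcfType) (N n : nat)
    (U : {vspace 'cV[R]_N}) : \dim U = n ->
  exists A : 'M[R]_(N, n), [/\ A^T *m A = 1%:M, forall c, A *m c \in U
    & forall u, u \in U -> A *m (A^T *m u) = u].
Proof.
elim: n U => [|n IHn] U dimU.
  exists 0; split=> [|c|u]; first by apply/matrixP => - [].
    by rewrite mul0mx mem0v.
  move/eqP: dimU; rewrite dimv_eq0 => /eqP -> /[!memv0] /eqP ->.
  by rewrite !mulmx0.
have [|e eU ee] := @exists_unit_vector _ _ U; first by rewrite -dimv_eq0 dimU.
pose f : 'Hom('cV[R]_N, 'cV[R]_1) := linfun (mulmx e^T).
have fE u : f u = e^T *m u by rewrite lfunE.
have dimker : \dim (U :&: lker f) = n.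
  have := limg_ker_dim f U; rewrite dimU.
  (* The image of [U] lies in a line and contains [f e = 1], so the kernel loses exactly one
     dimension. *)
  suff -> : \dim (f @: U) = 1%N by rewrite addn1 => -[].
  apply/eqP; rewrite eqn_leq; apply/andP; split.
    by rewrite (leq_trans (dimvS (subvf _)))// dimvf/= /dim/= muln1.
  rewrite lt0n dimv_eq0; apply/negP => /eqP fU0.
  have := memv_img f eU; rewrite fU0 memv0 fE ee => /eqP/matrixP/(_ 0 0)/eqP.
  by rewrite !mxE oner_eq0.
have [A [AA AU AK]] := IHn _ dimker.
have eA : e^T *m A = 0.
  apply/matrixP => i j.
  have := AU (delta_mx j 0); rewrite memv_cap memv_ker fE mulmxA => /andP[_].
  rewrite -colE => /eqP/matrixP/(_ i 0).
  by rewrite [col _ _ _ _]mxE => ->; rewrite !mxE.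
have Ae : A^T *m e = 0 by apply: trmx_inj; rewrite trmx_mul trmxK eA trmx0.
rewrite -[n.+1]/(1 + n)%N; exists (row_mx e A); split.
- by rewrite tr_row_mx mul_col_row ee AA eA Ae -scalar_mx_block.
- move=> c; rewrite -[c]vsubmxK mul_row_col memvD//.
    by rewrite [usubmx _]mx11_scalar mul_mx_scalar memvZ.
  by have := AU (dsubmx c); rewrite memv_cap => /andP[].
- move=> u uU; rewrite tr_row_mx mul_col_mx mul_row_col.
  (* Removing from [u] its component along [e] lands in the kernel, where [A] is a frame;
     [A^T *m e = 0] then discards the correction. *)
  have eeuU : e *m (e^T *m u) \in U.
    by rewrite [e^T *m u]mx11_scalar mul_mx_scalar memvZ.
  have /AK : u - e *m (e^T *m u) \in (U :&: lker f)%VS.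
    rewrite memv_cap memvB// memv_ker fE mulmxBr [e^T *m (e *m _)]mulmxA ee.
    by rewrite mul1mx subrr eqxx.
  rewrite mulmxBr [A^T *m (e *m _)]mulmxA Ae mul0mx subr0 => ->.
  by rewrite addrC subrK.
Qed.

Lemma dim_act_space (R : realType) (N : nat) (g : 'M[R]_N)
    (U : {vspace 'cV[R]_N}) :
  g \in orthogonal_group R N -> \dim (act_space g U) = \dim U.
Proof.
rewrite inE => /eqP gg; apply: limg_dim_eq; apply/eqP; rewrite -subv0.
apply/subvP => u; rewrite memv_cap memv_ker lfunE/= => /andP[_ /eqP gu].
by rewrite memv0 -[u]mul1mx -gg -mulmxA gu mulmx0.
Qed.

(** An orthogonal matrix preserves dimension, so the inclusion of the image is already an
    equality. *)
Lemma act_space_eq (R : realType) (N : nat) (g : 'M[R]_N)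
    (U W : {vspace 'cV[R]_N}) :
  g \in orthogonal_group R N -> \dim U = \dim W ->
  (forall u, u \in U -> g *m u \in W) -> act_space g U = W.
Proof.
move=> gO dimUW gUW; apply/eqP; rewrite eqEdim dim_act_space// dimUW leqnn andbT.
by apply/subvP => _ /memv_imgP[u uU ->]; rewrite lfunE/= gUW.
Qed.

Lemma orthogonal_subspaces_mulmx_eq0 (R : realType) (N m n : nat)
    (U V : {vspace 'cV[R]_N}) (A : 'M[R]_(N, m)) (B : 'M[R]_(N, n)) :
  orthogonal_subspaces U V -> (forall c, A *m c \in U) ->
  (forall c, B *m c \in V) -> A^T *m B = 0.
Proof.
move=> UV AU BV; apply/matrixP => i j.
have /matrixP/(_ 0 0) := UV _ _ (AU (delta_mx i 0)) (BV (delta_mx j 0)).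
rewrite -!colE !mxE => uv0; rewrite -[RHS]uv0; apply: eq_bigr => k _.
by rewrite !mxE.
Qed.

Lemma orthoflag_isometry (R : realType) (N : nat) (V W : orthoflag R N)
    (s : 'I_(flag_length V) -> 'I_(flag_length W)) :
  injective s ->
  (forall j, \dim (flag_space j) = \dim (flag_space (s j))) ->
  exists2 g, g \in orthogonal_group R N &
    forall j u, u \in flag_space j -> g *m u \in flag_space (s j).
Proof.
move=> s_inj dimVW.
have [A frameA] := fin_all_exists (fun j : 'I_(flag_length V) =>
  exists_orthonormal_frame (erefl (\dim (flag_space j)))).
(* Using [dimVW] here gives [B j] as many columns as [A j], so that [B j *m (A j)^T] is well
   typed. *)
have [B frameB] := fin_all_exists (fun j : 'I_(flag_length V) =>
  exists_orthonormal_frame (esym (dimVW j))).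
have AV j c : A j *m c \in flag_space j by case: (frameA j).
have BW j c : B j *m c \in flag_space (s j) by case: (frameB j).
have BB i j : i != j -> (B i)^T *m B j = 0.
  move=> ij; apply: orthogonal_subspaces_mulmx_eq0 (BW i) (BW j).
  by apply: flag_orthogonal; rewrite (inj_eq s_inj).
(* The vector [u] is treated as a matrix with one column. *)
have Au i j u : i != j -> u \in flag_space j -> (A i)^T *m u = 0.
  move=> ij uV; apply: orthogonal_subspaces_mulmx_eq0 (AV i) _.
    exact: flag_orthogonal ij.
  by move=> c; rewrite [c]mx11_scalar mul_mx_scalar memvZ.
pose P := \sum_j A j *m (A j)^T.
have P1 : P = 1%:M.
  (* Decompose [u] along the flag: on each component only the projector of its own block
     survives. *)
  suff Pu (u : 'cV_N) : P *m u = u.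
    apply/matrixP => i j; have /colP/(_ i) := Pu (delta_mx j 0).
    by rewrite -colE mxE => ->; rewrite !mxE andbT.
  have /memv_sumP[v vV ->] : u \in (\sum_j flag_space (o := V) j)%VS.
    by rewrite flag_full memvf.
  rewrite mulmx_sumr; apply: eq_bigr => j _.
  rewrite mulmx_suml (bigD1 j)//= big1 ?addr0 => [|i ij].
    by rewrite -mulmxA; have [_ _ ->] := frameA j; rewrite ?vV.
  by rewrite -mulmxA (Au _ _ _ ij (vV j isT)) mulmx0.
exists (\sum_j B j *m (A j)^T).
  (* In the expanded double sum, [BB] kills the cross terms and the diagonal terms add up to [P]. *)
  rewrite inE; apply/eqP; rewrite -[RHS]P1 [(\sum_j _)^T]raddf_sum/= mulmx_suml.
  apply: eq_bigr => i _; rewrite mulmx_sumr (bigD1 i)//= big1 ?addr0 => [|j ij].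
    rewrite trmx_mul trmxK mulmxA -[_ *m B i]mulmxA.
    by have [-> _ _] := frameB i; rewrite mulmx1.
  rewrite trmx_mul trmxK mulmxA -[_ *m B j]mulmxA BB ?mulmx0 ?mul0mx//.
  by rewrite eq_sym.
move=> j u uV; rewrite mulmx_suml memv_suml// => i _; rewrite -mulmxA.
have [->|ij] := eqVneq i j; first exact: BW.
by rewrite (Au _ _ _ ij uV) mulmx0 mem0v.
Qed.

Lemma orthoflag_reflection (R : realType) (N : nat) (V : orthoflag R N) :
  (0 < N)%N ->
  exists h, [/\ h \in orthogonal_group R N, \det h = -1 &
    forall (j : 'I_(flag_length V)) u,
      u \in flag_space j -> h *m u \in flag_space j].
Proof.
move=> N_gt0.
(* With no blocks the dimensions would sum to 0, against [0 < N]. *)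
have [i _] : exists i : 'I_(flag_length V), true.
  case: (posnP (flag_length V)) => [V0|]; last by move=> V0; exists (Ordinal V0).
  have := flag_dim_sum V; rewrite big1 => [/eqP|[i iV] _].
    by rewrite eq_sym eqn0Ngt N_gt0.
  by exfalso; move: iV; rewrite V0.
have [e eV ee] := exists_unit_vector (flag_neq0 i).
(* Householder reflection along [e]: it fixes the blocks orthogonal to [e], and its determinant is
   [1 - 2 = -1]. *)
pose h := 1%:M + (- 2) *: e *m e^T.
have hT : h^T = h.
  by rewrite /h linearD/= trmx1 trmx_mul trmxK linearZ/= -scalemxAl scalemxAr.
exists h; split.
- rewrite inE hT /h mulmxDl mul1mx mulmxDr mulmx1 -!scalemxAl -scalemxAr.
  rewrite -mulmxA [e^T *m _]mulmxA ee mul1mx scalerA.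
  rewrite -!scalerDl mulrNN mulr_natl [2 *+ 2]mulr2n addKr.
  by rewrite -addrA -scalerDl addNr scale0r addr0.
- rewrite /h det_add1_mul -scalemxAr ee det_mx11 !mxE.
  by rewrite eqxx mulr1 [2]mulr2n opprD addrA subrr add0r.
- move=> j u uV; rewrite /h mulmxDl mul1mx -mulmxA memvD//.
  have [ij|ij] := eqVneq i j.
    by rewrite [e^T *m u]mx11_scalar mul_mx_scalar !memvZ// -ij.
  by rewrite (flag_orthogonal ij eV uV) mulmx0 mem0v.
Qed.

Theorem theorem3p5 (R : realType) (N : nat) (V W : orthoflag R N) :
  (orthoflag_equiv (orthogonal_group R N) V W <->
     flag_length V = flag_length W /\
     npartition_equiv (flag_partition V) (flag_partition W)) /\
  (orthoflag_equiv (special_orthogonal_group R N) V W <->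
     flag_length V = flag_length W /\
     npartition_equiv (flag_partition V) (flag_partition W)).
Proof.
(* Both equivalences follow from the cycle: SO-equivalent, then O-equivalent, then equal dimensions,
   then SO-equivalent. *)
have SO_O : orthoflag_equiv (special_orthogonal_group R N) V W ->
            orthoflag_equiv (orthogonal_group R N) V W.
  by move=> [g + sV]; rewrite inE => /andP[gO _]; exists g.
have O_dim : orthoflag_equiv (orthogonal_group R N) V W ->
    flag_length V = flag_length W /\
    npartition_equiv (flag_partition V) (flag_partition W).
  move=> [g gO [s s_bij gV]].
  have e : flag_length V = flag_length W.
    by have := bij_eq_card s_bij; rewrite !card_ord.
  split=> //; exists e.
  (* Casting back along [e] turns [s] into a self-map of one index set, hence a permutation. *)
  have t_inj : injective (cast_ord (esym e) \o s).
    exact: inj_comp (@cast_ord_inj _ _ _) (bij_inj s_bij).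
  exists (perm t_inj) => j /=.
  by rewrite permE/= cast_ordKV -gV dim_act_space.
have dim_SO : flag_length V = flag_length W /\
    npartition_equiv (flag_partition V) (flag_partition W) ->
    orthoflag_equiv (special_orthogonal_group R N) V W.
  move=> [_ [e [s dimVW]]].
  pose t j := cast_ord e (s j).
  have t_bij : bijective t.
    apply: inj_card_bij; last by rewrite !card_ord e.
    exact: inj_comp (@cast_ord_inj _ _ _) perm_inj.
  have [g gO gV] := orthoflag_isometry (bij_inj t_bij) dimVW.
  suff [h hSO hV] : exists2 h, h \in special_orthogonal_group R N &
      forall j u, u \in flag_space j -> h *m u \in flag_space (t j).
    exists h => //; exists t => // j; apply: act_space_eq (hV j) => //.
      by move: hSO; rewrite inE => /andP[].
    exact: dimVW.
  have [g1|g1] := eqVneq (\det g) 1; first by exists g; rewrite // inE gO g1 eqxx.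
  have gN1 : \det g = -1.
    move: gO; rewrite inE => /eqP/(congr1 determinant).
    rewrite det_mulmx det_tr det1 => /eqP.
    by rewrite -expr2 sqrf_eq1 (negPf g1) => /eqP.
  have N_gt0 : (0 < N)%N.
    (* The empty determinant is 1, which [g1] excludes. A fresh [n] permits the substitution, as the
       types of [V] and [W] depend on [N]. *)
    have det0 n (h : 'M[R]_n) : n = 0%N -> \det h = 1.
      by move=> n0; subst n; rewrite det_mx00.
    by rewrite lt0n; apply: contra_neq g1; apply: det0.
  have [h [hO hN1 hV]] := orthoflag_reflection V N_gt0.
  exists (g *m h); last by move=> j u uV; rewrite -mulmxA gV ?hV.
  rewrite !inE det_mulmx gN1 hN1 mulrNN mulr1 eqxx andbT trmx_mul mulmxA.
  move: gO hO; rewrite !inE => /eqP gg /eqP hh.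
  by rewrite -[_ *m g]mulmxA gg mulmx1 hh.
by split; split=> [|/dim_SO]; auto.
Qed.
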